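(* Let $\theta\in\mathbb{R}$. There exists $M\in\mathbb{N}$ such that $(m+1)\,d_\theta(m)<1+\frac{2}{\sqrt5}$ for all integers $m\ge M$ if and only if $\theta\asymp\varphi$.
   Context: For $\theta\in\mathbb{R}$ and an integer $m\ge 0$, let $d_\theta(m)=\sup\{|I| : I\subset\mathbb{R}\text{ an interval},\ (I+\mathbb{Z})\cap\{0,\theta,2\theta,\dots,m\theta\}=\emptyset\}$, where $|I|$ is the length of $I$; this is the largest gap modulo 1 among the $m+1$ multiples $0,\theta,\dots,m\theta$. $\mathbb{N}$ is the set of positive integers. $\varphi=\frac{1+\sqrt5}{2}$ is the golden ratio, whose continued fraction is $[1,1,1,\dots]$. For two infinite (simple) continued fractions $\theta,\sigma$, $\theta\asymp\sigma$ means that there are positive integers $m,n$ such that the continued fraction expansions of $\theta$ and $\sigma$ agree after removing the prefixes of length $m$ and $n$, respectively. (A rational number has no infinite continued fraction and is not equivalent to $\varphi$.) *)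

(* Defs.v *)
From mathcomp Require Import all_boot all_order all_algebra.
From mathcomp Require Import all_classical all_reals all_analysis.
Set Implicit Arguments.
Unset Strict Implicit.
Unset Printing Implicit Defensive.
Import Order.TTheory GRing.Theory Num.Theory.
Import numFieldNormedType.Exports.
Local Open Scope classical_set_scope.
Local Open Scope ring_scope.

(* No interval is excluded a priori: [I] may be empty, degenerate, open,
   closed, half-open or unbounded; its length is its Lebesgue measure. The
   supremum is taken in the extended reals, so it is never a default value. *)
Definition largest_gap (R : realType) (theta : R) (m : nat) : \bar R :=
  ereal_sup [set (@lebesgue_measure R) I | I in [set I : set R |
    is_interval I /\
    [set x + z%:~R | x in I & z in [set: int]] `&`
      [set j%:R * theta | j in [set j : nat | (j <= m)%N]] = set0]].

(* [cfrac R a n] is the finite continued fraction [a 0; a 1, ..., a n]. *)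
Fixpoint cfrac (R : realType) (a : nat -> int) (n : nat) : R :=
  if n is n'.+1 then (a 0%N)%:~R + (cfrac R (fun k => a k.+1) n')^-1
  else (a 0%N)%:~R.

(* The head partial quotient [a 0] may be any integer. *)
Definition simple_cf_of (R : realType) (a : nat -> int) (x : R) : Prop :=
  (forall k : nat, 0 < a k.+1) /\ (cfrac R a n @[n --> \oo] --> x).

(* A rational number is the value of no infinite simple continued fraction,
   hence is equivalent to nothing. *)
Definition cf_equiv (R : realType) (x y : R) : Prop :=
  exists a b : nat -> int,
    [/\ simple_cf_of a x, simple_cf_of b y &
      exists m n : nat, [/\ (0 < m)%N, (0 < n)%N &
        forall k : nat, a (m + k)%N = b (n + k)%N]].

Definition golden_ratio (R : realType) : R := (1 + Num.sqrt 5) / 2.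

(* Main.v *)
Require Import Defs.
From mathcomp Require Import all_boot all_order all_algebra.
From mathcomp Require Import all_classical all_reals all_analysis.
From mathcomp Require Import ring lra zify.
Import Order.TTheory GRing.Theory Num.Theory.
Import numFieldNormedType.Exports.
Local Open Scope classical_set_scope.
Local Open Scope ring_scope.

(** Write [theta = [a 0; a 1, ...]] with convergents [p_n / q_n] and errors
    [e_n = |q_n theta - p_n|], so that [q_n e_(n-1) + q_(n-1) e_n = 1].  With
    [N] points, a gap of length [e_(n-1)] is present while
    [N < 2 q_n + q_(n-1)], and every gap has length at most [e_(n-1)] once
    [q_n + q_(n-1) <= N].  If [a_(n+1) >= 2], then [e_(n-1) >= 2 e_n] and
    [(2 q_n + q_(n-1)) e_(n-1) >= 2], which exceeds [1 + 2 / sqrt 5].  If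
    [a_(n+1) = 1], the two thresholds are consecutive in [n], so the supremum
    of [N d] over the range is [(2 q_n + q_(n-1) - 1) e_(n-1)]; for a tail of
    ones the product [(2 q_n + q_(n-1)) e_(n-1)] differs from
    [1 + 2 / sqrt 5] by [o (e_(n-1))], and the term [- e_(n-1)] makes the
    inequality strict. *)

(** * Complete quotients, convergents and their errors *)

Definition complete_quotients {R : realType} (a : nat -> int) (x : nat -> R) :=
  forall k : nat, 1 < x k.+1 /\ x k = (a k)%:~R + (x k.+1)^-1.

(** [u] and [v] are the values at indices 0 and -1, so that one recurrence yields numerators and
    denominators alike. *)
Fixpoint cf_rec (a : nat -> int) (u v : int) (n : nat) : int :=
  if n is n1.+1 then
    if n1 is n2.+1 then a n1 * cf_rec a u v n1 + cf_rec a u v n2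
    else a 0%N * u + v
  else u.

(* Indices are shifted by one from the usual convergents [p_n / q_n] of
   [a 0; a 1, ...]: [den a n.+1] is [q_n] and [den a 0] is [q_(-1) = 0]. *)
Definition den (a : nat -> int) : nat -> int := cf_rec a 0 1.
Definition num (a : nat -> int) : nat -> int := cf_rec a 1 0.

(** The sign is kept because it tells on which side of 0 the multiple falls modulo 1. With the
    shifted indices, [|cf_err a x n|] is [e_(n-1)]. *)
Definition cf_err {R : realType} (a : nat -> int) (x : nat -> R) (n : nat) : R :=
  (den a n)%:~R * x 0%N - (num a n)%:~R.

Lemma complete_quotients_inv_lt1 {R : realType} (a : nat -> int) (x : nat -> R) k :
  complete_quotients a x -> 0 < (x k.+1)^-1 < 1.
Proof.
move=> /(_ k) [x1 _]; have x0 : 0 < x k.+1 by apply: lt_trans x1.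
by rewrite invr_gt0 x0 invf_lt1.
Qed.

Lemma complete_quotients_ge1 {R : realType} (a : nat -> int) (x : nat -> R) k :
  complete_quotients a x -> 1 <= a k.+1.
Proof.
move=> ax; have [x1 _] := ax k; have [_ xE] := ax k.+1.
have := complete_quotients_inv_lt1 a x k.+1 ax => /andP[i0 i1].
suff : 0 < a k.+1 by lia.
by rewrite -(ltr0z R); lra.
Qed.

Lemma denSS a n : den a n.+2 = a n.+1 * den a n.+1 + den a n.
Proof. by []. Qed.

Lemma numSS a n : num a n.+2 = a n.+1 * num a n.+1 + num a n.
Proof. by []. Qed.

(** The sign [(-1)^n] is recorded only as a unit [s] that is its own inverse, which suffices to
    solve for integer coordinates. *)
Lemma den_det a n :
  exists2 s : int, s * s = 1 & den a n.+1 * num a n - den a n * num a n.+1 = s.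
Proof.
elim: n => [|n [s ss IH]]; first by exists 1; rewrite // /den /num /=; ring.
exists (- s); first by rewrite mulrNN.
by rewrite denSS numSS -IH; ring.
Qed.

Lemma den_gt0 {R : realType} {a : nat -> int} {x : nat -> R} :
  complete_quotients a x -> forall n : nat, 0 <= den a n /\ 1 <= den a n.+1.
Proof.
move=> ax; elim=> [|n [d0 d1]]; first by rewrite /den /= mulr0.
have a1 := complete_quotients_ge1 a x n ax; rewrite denSS; split; first by rewrite (le_trans _ d1).
have : den a n.+1 <= a n.+1 * den a n.+1 by rewrite ler_peMl// (le_trans _ d1).
lia.
Qed.

Lemma den_le_rec {R : realType} {a : nat -> int} {x : nat -> R} n :
  complete_quotients a x -> den a n.+1 + den a n <= den a n.+2.
Proof.
move=> ax; have [_ d1] := den_gt0 ax n.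
have a1 := complete_quotients_ge1 a x n ax; rewrite denSS lerD2r.
by rewrite ler_peMl// (le_trans _ d1).
Qed.

Lemma den_ge {R : realType} {a : nat -> int} {x : nat -> R} n :
  complete_quotients a x -> n%:Z <= den a n.+1.
Proof.
move=> ax; elim: n => [|[|n] IH]; first by case: (den_gt0 ax 1%N).
  by case: (den_gt0 ax 1%N).
have [_ d1] := den_gt0 ax n; have := den_le_rec n.+1 ax; lia.
Qed.

Lemma cf_err0 {R : realType} a (x : nat -> R) : cf_err a x 0 = -1.
Proof. by rewrite /cf_err /den /num /= mul0r sub0r. Qed.

Lemma cf_err1 {R : realType} a (x : nat -> R) : cf_err a x 1 = x 0%N - (a 0%N)%:~R.
Proof. by rewrite /cf_err /den /num /= mulr0 add0r mul1r mulr1 addr0. Qed.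

(** Errors obey the same recurrence as convergents, so their successive ratios are complete
    quotients up to sign. *)
Lemma cf_errS {R : realType} {a : nat -> int} {x : nat -> R} n :
  complete_quotients a x -> cf_err a x n = - (x n.+1 * cf_err a x n.+1).
Proof.
move=> ax; elim: n => [|n IH].
  have [x1 xE] := ax 0%N; rewrite cf_err0 cf_err1 xE addrAC subrr add0r.
  by rewrite mulfV// gt_eqF// (lt_trans _ x1).
have [x1 xE] := ax n.+1.
have x0 : x n.+2 != 0 by rewrite gt_eqF// (lt_trans _ x1).
have -> : cf_err a x n.+2 = (a n.+1)%:~R * cf_err a x n.+1 + cf_err a x n.
  by rewrite /cf_err denSS numSS !rmorphD !rmorphM /=; ring.
by rewrite IH xE; field.
Qed.

Lemma cf_err_norm {R : realType} {a : nat -> int} {x : nat -> R} n :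
  complete_quotients a x ->
  `|cf_err a x n| = x n.+1 * `|cf_err a x n.+1|.
Proof.
move=> ax; have [x1 _] := ax n.
by rewrite (cf_errS n ax) normrN normrM gtr0_norm// (lt_trans _ x1).
Qed.

Lemma cf_err_neq0 {R : realType} {a : nat -> int} {x : nat -> R} n :
  complete_quotients a x -> cf_err a x n != 0.
Proof.
move=> ax; elim: n => [|n]; first by rewrite cf_err0 oppr_eq0 oner_eq0.
by rewrite (cf_errS n ax) oppr_eq0 mulf_eq0 negb_or => /andP[].
Qed.

Lemma cf_err_opp_sign {R : realType} {a : nat -> int} {x : nat -> R} n :
  complete_quotients a x ->
  (0 < cf_err a x n /\ cf_err a x n.+1 < 0) \/
  (cf_err a x n < 0 /\ 0 < cf_err a x n.+1).
Proof.
move=> ax; have [x1 _] := ax n.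
have x0 : 0 < x n.+1 by rewrite (lt_trans _ x1).
have := cf_err_neq0 n ax; rewrite neq_lt (cf_errS n ax).
by rewrite oppr_lt0 oppr_gt0 pmulr_rgt0// pmulr_rlt0// => /orP[]; [right|left]; split.
Qed.

Lemma den_err_sum {R : realType} {a : nat -> int} {x : nat -> R} n :
  complete_quotients a x ->
  (den a n.+1)%:~R * `|cf_err a x n| + (den a n)%:~R * `|cf_err a x n.+1| = 1.
Proof.
move=> ax; elim: n => [|n IH].
  by rewrite cf_err0 /den /= mulr0 mul0r add0r addr0 normrN normr1 mulr1.
have [x1 xE] := ax n.+1.
have x0 : x n.+2 != 0 by rewrite gt_eqF// (lt_trans _ x1).
rewrite -[RHS]IH (cf_err_norm n ax) xE (cf_err_norm n.+1 ax) denSS.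
by rewrite rmorphD rmorphM /=; field.
Qed.

(** * Gaps between the multiples modulo 1 *)

(** In the basis of two consecutive convergents [(N, Z)] has integer coordinates [al], [be], and the
    quotient equals [al - be / x n.+1]. Since [0 < 1 / x n.+1 < 1], a value in (0, 1) forces either
    [be >= 1] and [al >= 1], or [be <= -1] and [al <= 0]. *)
Lemma cf_err_between {R : realType} {a : nat -> int} {x : nat -> R} n (N Z : int) :
  complete_quotients a x ->
  0 < (N%:~R * x 0%N - Z%:~R) / cf_err a x n < 1 ->
  den a n.+1 + den a n <= N \/ N <= - den a n.+1.
Proof.
move=> ax; have [s ss sE] := den_det a n.
pose al := s * (Z * den a n.+1 - N * num a n.+1).
pose be := s * (N * num a n - Z * den a n).
have NE : N = al * den a n + be * den a n.+1.
  by rewrite -[LHS]mul1r -ss -{2}sE /al /be; ring.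
have ZE : Z = al * num a n + be * num a n.+1.
  by rewrite -[LHS]mul1r -ss -{2}sE /al /be; ring.
have e0 := cf_err_neq0 n.+1 ax.
have [x1 _] := ax n; have x0 : 0 < x n.+1 by rewrite (lt_trans _ x1).
have -> : (N%:~R * x 0%N - Z%:~R) / cf_err a x n = al%:~R - be%:~R / x n.+1.
  transitivity ((al%:~R * cf_err a x n + be%:~R * cf_err a x n.+1) / cf_err a x n).
    by congr (_ / _); rewrite /cf_err [in LHS]NE [in LHS]ZE !rmorphD !rmorphM /=; ring.
  by rewrite (cf_errS n ax); field; rewrite e0 gt_eqF.
have [i0 i1] := andP (complete_quotients_inv_lt1 a x n ax).
have [d0 d1] := den_gt0 ax n.
move: (x n.+1)^-1 i0 i1 => y y0 y1 /andP[lo hi].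
have [be1|be0] := lerP 1 be.
  have al1 : 1 <= al.
    suff : 0 < al by lia.
    rewrite -(ltr0z R); move: be1; rewrite -(ler1z R) => be1; nra.
  left; rewrite NE addrC lerD//; first by rewrite ler_peMl.
  by rewrite ler_peMl// (le_trans _ d1).
have [be0'|bem1] : be = 0 \/ be <= -1 by lia.
  by move: lo hi; rewrite be0' mul0r subr0 ltr0z ltrz1; lia.
have al0 : al <= 0.
  suff : al < 1 by lia.
  have : be%:~R < 0 :> R by rewrite ltrz0; lia.
  rewrite -(ltrz1 R); nra.
right; rewrite NE -[leRHS]add0r lerD//; first by rewrite mulr_le0_ge0.
by rewrite -mulN1r ler_wpM2r// (le_trans _ d1).
Qed.

Lemma largest_gap_ge {R : realType} {a : nat -> int} {x : nat -> R} n m :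
  complete_quotients a x -> m%:Z + 2 <= 2 * den a n.+1 + den a n ->
  (`|cf_err a x n|%:E <= largest_gap (x 0%N) m)%E.
Proof.
move=> ax mle; have [d0 d1] := den_gt0 ax n.
(* For [0 <= i <= m] this choice keeps [i - j] strictly between [- den a n.+1] and
   [den a n.+1 + den a n], so no multiple falls between [j * theta] and [j * theta + cf_err a x n]
   modulo 1. *)
pose j := den a n.+1 - 1.
have core (i : nat) (z : int) (y : R) : (i <= m)%N ->
    y + z%:~R = i%:R * x 0%N ->
    ~ 0 < (y - (j%:~R * x 0%N)) / cf_err a x n < 1.
  move=> im /(congr1 (fun t => t - z%:~R)); rewrite addrK => -> h.
  have := cf_err_between n (i%:Z - j) z ax.
  have -> : (i%:Z - j)%:~R * x 0%N - z%:~R = i%:R * x 0%N - z%:~R - j%:~R * x 0%N.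
    by rewrite rmorphB /= -pmulrn; ring.
  by move=> /(_ h); rewrite /j; lia.
pose p := j%:~R * x 0%N; pose e := cf_err a x n.
have e0 : e != 0 := cf_err_neq0 n ax.
have pe0 : `|e| > 0 by rewrite normr_gt0.
pose lo := Num.min p (p + e).
have hiE : lo + `|e| = Num.max p (p + e).
  rewrite /lo; case: (ltgtP e 0) e0 => // es _.
    by rewrite min_r ?max_l ?ltr0_norm; lra.
  by rewrite min_l ?max_r ?gtr0_norm; lra.
apply: ereal_sup_ubound; exists ([set` `]lo, lo + `|e|[] : set R).
  split; first exact: interval_is_interval.
  apply/seteqP; split => // _ [[y yI [z _ <-]] [i /= im iE]].
  apply: (core i z y im (esym iE)); rewrite -/p -/e.
  move: yI; rewrite /= in_itv /= hiE /lo.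
  case: (ltgtP e 0) e0 => // es _.
    rewrite min_r ?max_l; [|lra|lra] => /andP[y1 y2].
    by rewrite ltr_ndivlMr// ltr_ndivrMr// mul0r mul1r; apply/andP; split; lra.
  rewrite min_l ?max_r; [|lra|lra] => /andP[y1 y2].
  by rewrite ltr_pdivlMr// ltr_pdivrMr// mul0r mul1r; apply/andP; split; lra.
rewrite lebesgue_measure_itv /= lte_fin ltrDl pe0 -EFinB.
by congr EFin; ring.
Qed.

(** Enclosing [I] in [[inf I, sup I]] treats all kinds of intervals at once; the distance bound at
    one point of [I] makes [I] bounded, so [inf] and [sup] are not default values. *)
Lemma lebesgue_measure_interval_le {R : realType} (I : set R) (w : R) :
  is_interval I -> 0 <= w -> (forall c d : R, I c -> I d -> d - c <= w) ->
  (lebesgue_measure I <= w%:E)%E.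
Proof.
move=> itvI w0 Iw; have [->|/set0P[c Ic]] := eqVneq I set0.
  by rewrite measure0 lee_fin.
have ubI : has_ubound I by exists (c + w) => d Id; have := Iw c d Ic Id; lra.
have lbI : has_lbound I by exists (c - w) => d Id; have := Iw d c Id Ic; lra.
have I0 : I !=set0 by exists c.
have supw : sup I - inf I <= w.
  rewrite lerBlDr; apply: ge_sup => // d Id; rewrite addrC -lerBlDr.
  by apply: lb_le_inf => // b Ib; have := Iw b d Ib Id; lra.
have sub : I `<=` [set` `[inf I, sup I]].
  by move=> d Id; rewrite /= in_itv /= ge_inf// ub_le_sup.
apply: (@le_trans _ _ (lebesgue_measure ([set` `[inf I, sup I]] : set R))).
  apply: le_measure => //; rewrite inE; first exact: measurable_realfun.is_interval_measurable.
  exact: measurable_itv.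
rewrite lebesgue_measure_itv /= lte_fin; case: ifP => _; last by rewrite lee_fin.
by rewrite -EFinB lee_fin.
Qed.

(** Steps of at least [eps] pass [c] after finitely many moves, and a step of at most [w] cannot
    jump over []c, d[]. *)
Lemma step_into_interval {R : realType} (S : set R) (eps w c d : R) :
  0 < eps -> (forall s, S s -> exists2 t, S t & s + eps <= t <= s + w) ->
  (exists2 s, S s & s <= c) -> c + w < d -> exists2 s, S s & c < s < d.
Proof.
move=> eps0 step [s0 Ss0 s0c] cwd.
suff walk k s : S s -> s <= c -> c < s + eps *+ k -> exists2 s, S s & c < s < d.
  apply: (walk (Num.truncn ((c - s0) / eps)).+1 s0) => //.
  by rewrite -ltrBlDl -mulr_natr mulrC -ltr_pdivrMr// truncnS_gt.
elim: k s => [|k IH] s Ss sc; first by rewrite mulr0n addr0 ltNge sc.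
have [t St /andP[st ts]] := step s Ss.
rewrite mulrS => cs; have [tc|ct] := leP t c.
  by apply: (IH t) => //; lra.
by exists t => //; rewrite ct; lra.
Qed.

(** Consecutive errors have opposite signs, so adding one of [den a n], [den a n.+1] to the index,
    or subtracting the other, moves a point to the right by at most [|cf_err a x n|]. Once [m + 1]
    reaches the sum of both, one of these moves keeps the index in [[0, m]]. *)
Lemma largest_gap_le {R : realType} {a : nat -> int} {x : nat -> R} n m :
  complete_quotients a x -> den a n.+1 + den a n <= m%:Z + 1 ->
  (largest_gap (x 0%N) m <= `|cf_err a x n|%:E)%E.
Proof.
move=> ax mle; have [d0 d1] := den_gt0 ax n.
apply: ge_ereal_sup => _ [I [itvI I0] <-].
apply: lebesgue_measure_interval_le => // c d Ic Id.
rewrite leNgt; apply/negP => cd.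
pose S : set R := [set s | exists2 i : nat, (i <= m)%N &
  exists z : int, s = i%:R * x 0%N - z%:~R].
have [x1 _] := ax n; have x0 : 0 < x n.+1 by rewrite (lt_trans _ x1).
have e0 : 0 < `|cf_err a x n.+1| by rewrite normr_gt0 cf_err_neq0.
have ee : `|cf_err a x n.+1| <= `|cf_err a x n|.
  by rewrite (cf_err_norm n ax) ler_peMl// ltW.
have move_by (i : nat) (z g : int) k : 0 <= i%:Z + g * den a k <= m%:Z ->
    S (i%:R * x 0%N - z%:~R + g%:~R * cf_err a x k).
  set q := g * den a k => iq; exists (absz (i%:Z + q)); first lia.
  exists (z + g * num a k); rewrite (pmulrn _ (absz _)) gez0_abs; last by case/andP: iq.
  by rewrite !rmorphD /= /q /cf_err !rmorphM /= -pmulrn; ring.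
have [s [i im [z ->]] /andP[cs sd]] : exists2 s, S s & c < s < d.
  apply: (@step_into_interval R S `|cf_err a x n.+1| `|cf_err a x n|) => //;
    last by lra.
    move=> _ [i im [z ->]].
    have [[en en1]|[en en1]] := cf_err_opp_sign n ax.
      rewrite (ltr0_norm en1) (gtr0_norm en) in ee *.
      have [id|di] := ltrP i%:Z (den a n.+1).
        by exists (i%:R * x 0%N - z%:~R + 1%:~R * cf_err a x n); [apply: move_by; lia|lra].
      by exists (i%:R * x 0%N - z%:~R + (-1)%:~R * cf_err a x n.+1); [apply: move_by; lia|lra].
    rewrite (gtr0_norm en1) (ltr0_norm en) in ee *.
    have [id|di] := ltrP i%:Z (den a n).
      by exists (i%:R * x 0%N - z%:~R + 1%:~R * cf_err a x n.+1); [apply: move_by; lia|lra].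
    by exists (i%:R * x 0%N - z%:~R + (-1)%:~R * cf_err a x n); [apply: move_by; lia|lra].
  exists (0%:R * x 0%N - (- Num.floor c)%:~R).
    by exists 0%N => //; eexists.
  by rewrite mul0r sub0r rmorphN opprK floor_le.
suff : [set x + z%:~R | x in I & z in [set: int]] (i%:R * x 0%N).
  move=> h; have : set0 (i%:R * x 0%N) by rewrite -I0; split => //; exists i.
  by [].
exists (i%:R * x 0%N - z%:~R); last by exists z => //; rewrite subrK.
by apply: (itvI c d) => //; rewrite !ltW.
Qed.

(** * Infinite continued fractions versus complete quotients *)

Lemma cfrac_bounds {R : realType} (a : nat -> int) (n : nat) :
  (forall k : nat, 0 < a k.+1) ->
  (a 0%N)%:~R <= cfrac R a n <= (a 0%N)%:~R + 1.
Proof.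
elim: n a => [|n IH] a a0 /=; first by rewrite lexx ler_wpDr.
have /andP[lo _] := IH (fun k => a k.+1) (fun k => a0 k.+1).
have a1 : 1 <= (a 1%N)%:~R :> R by rewrite ler1z; have := a0 0%N; lia.
have c1 := le_trans a1 lo; rewrite lerDl lerD2l invr_ge0 (le_trans ler01 c1)/=.
by rewrite invf_le1// (lt_le_trans ltr01 c1).
Qed.

(* Two steps of the expansion contract distances by a factor of at least 4. *)
Lemma complete_quotients_cfrac_dist {R : realType} (a : nat -> int) (x : nat -> R) n :
  complete_quotients a x -> `|cfrac R a n - x 0%N| <= 2 / 2 ^+ n.
Proof.
(* The contraction peels off two quotients at once, so the induction carries two consecutive
   indices. *)
move: a x n; suff both n a x : complete_quotients a x ->
    `|cfrac R a n - x 0%N| <= 2 / 2 ^+ n /\ `|cfrac R a n.+1 - x 0%N| <= 2 / 2 ^+ n.+1.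
  by move=> a x n /(both n)[].
elim: n a x => [|n IH] a x ax.
  have [_ xE] := ax 0%N; have /andP[i0 i1] := complete_quotients_inv_lt1 a x 0 ax.
  have a1 : 1 <= (a 1%N)%:~R :> R by rewrite ler1z (complete_quotients_ge1 a x).
  have j1 : 0 <= ((a 1%N)%:~R : R)^-1 <= 1.
    by rewrite invr_ge0 invf_le1 ?(lt_le_trans ltr01 a1)// a1 (le_trans ler01 a1).
  rewrite /= xE expr0 expr1 divr1 divff//; move/andP: j1 => [j0 j1].
  by rewrite !ler_norml; split; apply/andP; split; lra.
split; first by have [] := IH a x ax.
have [dist _] := IH _ (fun k => x k.+2) (fun k => ax k.+2).
have [x1 xE] := ax 0%N; have [x2 x1E] := ax 1%N.
have a1 : 1 <= (a 1%N)%:~R :> R by rewrite ler1z (complete_quotients_ge1 a x).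
have /andP[c2 _] := cfrac_bounds (R := R) (fun k => a k.+2) n
  (fun k => lt_le_trans ltr01 (complete_quotients_ge1 a x k.+2 ax)).
have a2 : 1 <= (a 2%N)%:~R :> R by rewrite ler1z (complete_quotients_ge1 a x).
have {a2}c2 := le_trans a2 c2.
rewrite [cfrac _ _ _]/= xE x1E exprS exprS.
move: dist c2 x2 a1; set c := cfrac _ _ _; set y := x 2%N; set b := (a 1%N)%:~R.
have : 0 < 2 ^+ n :> R by rewrite exprn_gt0.
set h := 2 ^+ n => h0 dist c1 y1 b1.
have bc : 2 <= b * c + 1 by have := ler_pM ler01 ler01 b1 c1; lra.
have by' : 2 <= b * y + 1 by have := ler_pM ler01 ler01 b1 (ltW y1); lra.
have -> : (a 0%N)%:~R + (b + c^-1)^-1 - ((a 0%N)%:~R + (b + y^-1)^-1)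
    = (c - y) / ((b * c + 1) * (b * y + 1)).
  by field; rewrite !gt_eqF; lra.
have -> : 2 / (2 * (2 * h)) = (2 / h) / (2 * 2) by field; rewrite gt_eqF.
have P0 : 0 < (b * c + 1) * (b * y + 1) by rewrite mulr_gt0; lra.
rewrite normrM normfV (gtr0_norm P0) ler_pM// ?invr_ge0 ?(ltW P0)//.
by rewrite lef_pV2 ?posrE// ler_pM.
Qed.

Lemma complete_quotients_cf {R : realType} (a : nat -> int) (x : nat -> R) :
  complete_quotients a x -> simple_cf_of a (x 0%N).
Proof.
move=> ax; split=> [k|]; first exact: lt_le_trans (complete_quotients_ge1 a x k ax).
have h1 : `|2^-1| < 1 :> R by rewrite ger0_norm; lra.
have /cvgr0Pnorm_le small := @cvg_geometric R 2 _ h1.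
apply/cvgrPdist_le => e e0; near=> n.
rewrite distrC; apply: le_trans (complete_quotients_cfrac_dist _ _ n ax) _.
have : `|geometric 2 2^-1 n| <= e by near: n; exact: small.
by apply: le_trans; rewrite /= -exprVn ler_norm.
Unshelve. all: by end_near.
Qed.

(** A strict bound need not survive a limit, so the closed bound [a 0 + 1 / (a 1 + 1)], valid from
    index 1 on, is passed to it instead. Strictness later allows inverting the limit. *)
Lemma simple_cf_head {R : realType} (a : nat -> int) (t : R) :
  simple_cf_of a t -> (a 0%N)%:~R < t.
Proof.
move=> [a0 at_]; have a1 : 1 <= (a 1%N)%:~R :> R by rewrite ler1z; have := a0 0%N; lia.
apply: (@lt_le_trans _ _ ((a 0%N)%:~R + ((a 1%N)%:~R + 1)^-1)).
  by rewrite ltrDl invr_gt0; lra.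
apply: (@closed_cvg _ _ \oo _ (fun n => cfrac R a n.+1)
  [set y | (a 0%N)%:~R + ((a 1%N)%:~R + 1)^-1 <= y]).
- exact: closed_ge.
- near=> n; have /andP[] := cfrac_bounds (R := R) (fun k => a k.+1) n (fun k => a0 k.+1).
  by rewrite /= lerD2l => lo hi; rewrite lef_pV2 ?posrE//; lra.
- by move: at_; rewrite -(cvg_shiftS (fun n => cfrac R a n)).
Unshelve. all: by end_near.
Qed.

Lemma simple_cf_tail {R : realType} (a : nat -> int) (t : R) :
  simple_cf_of a t -> simple_cf_of (fun k => a k.+1) (t - (a 0%N)%:~R)^-1.
Proof.
move=> cf; have t0 := simple_cf_head a t cf; case: cf => a0 at_.
split=> [k|]; first exact: a0.
have -> : (fun n => cfrac R (fun k => a k.+1) n)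
    = (fun n => (cfrac R a n.+1 - (a 0%N)%:~R)^-1).
  by apply/funext => n /=; rewrite addrAC subrr add0r invrK.
apply: cvgV; first by rewrite subr_eq0 gt_eqF.
apply: cvgB; last exact: cvg_cst.
by move: at_; rewrite -(cvg_shiftS (fun n => cfrac R a n)).
Qed.

(** The iterates of [t -> 1 / (t - a k)] are the values of the tails; each exceeds its head
    quotient, which is at least 1 after the first. *)
Lemma simple_cf_complete_quotients {R : realType} (a : nat -> int) (t : R) :
  simple_cf_of a t -> exists x : nat -> R, [/\ complete_quotients a x, x 0%N = t &
    forall k, simple_cf_of (fun i => a (k + i)%N) (x k)].
Proof.
move=> cf; pose x := fix x k : R :=
  if k is k'.+1 then (x k' - (a k')%:~R)^-1 else t.
have xcf k : simple_cf_of (fun i => a (k + i)%N) (x k).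
  elim: k => [//|k /simple_cf_tail].
  rewrite addn0 /=; congr simple_cf_of.
  by apply/funext => i; rewrite addnS.
exists x; split=> // k; split; last by rewrite /= invrK addrC subrK.
have := simple_cf_head _ _ (xcf k.+1); rewrite addn0; apply: le_lt_trans.
have [/(_ 0%N)] := xcf k; rewrite addn1 ler1z; lia.
Qed.

(** * The expansion of the golden ratio *)

Lemma golden_ratioE {R : realType} :
  1 < golden_ratio R < 2 /\ golden_ratio R = 1 + (golden_ratio R)^-1.
Proof.
have s0 : 0 <= Num.sqrt 5 :> R by apply: sqrtr_ge0.
have ss : Num.sqrt 5 * Num.sqrt 5 = 5 :> R by rewrite -expr2 sqr_sqrtr.
have g1 : 1 < golden_ratio R < 2 by rewrite /golden_ratio; apply/andP; split; nra.
split=> //; have g0 : golden_ratio R != 0 by rewrite gt_eqF//; lra.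
apply: (mulIf g0); rewrite mulrDl mulVf// /golden_ratio; nra.
Qed.

Lemma golden_complete_quotients {R : realType} :
  complete_quotients (fun=> 1) (fun=> golden_ratio R).
Proof. by move=> k; have [/andP[]] := @golden_ratioE R. Qed.

(** Uniqueness is needed because [cf_equiv] allows any expansion of the golden ratio. A value in (1,
    2) minus a part in (0, 1) leaves only the integer 1, and [phi = 1 + 1 / phi] passes [phi] on. *)
Lemma complete_quotients_golden {R : realType} {a : nat -> int} {x : nat -> R} :
  complete_quotients a x -> x 0%N = golden_ratio R ->
  forall k, a k = 1 /\ x k = golden_ratio R.
Proof.
move=> ax x0; have [/andP[g1 g2] gE] := @golden_ratioE R.
have a1 k : x k = golden_ratio R -> a k = 1.
  move=> xk; have [_ ] := ax k; rewrite xk => xE.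
  have /andP[i0 i1] := complete_quotients_inv_lt1 a x k ax.
  have : 0 < (a k)%:~R :> R by lra.
  have : (a k)%:~R < 2%:~R :> R by lra.
  rewrite ltr_int ltr0z; lia.
elim=> [|k [ak xk]]; first by split=> //; exact: a1.
suff xk1 : x k.+1 = golden_ratio R by split=> //; exact: a1.
have [_] := ax k; rewrite xk ak {1}gE => /addrI /invr_inj; exact: esym.
Qed.

(** * Rational and irrational numbers *)

Definition int_commensurable {R : realType} (t : R) :=
  exists p q : int, q != 0 /\ q%:~R * t = p%:~R.

Lemma irrational_complete_quotients {R : realType} (t : R) :
  ~ int_commensurable t ->
  exists (a : nat -> int) (x : nat -> R), complete_quotients a x /\ x 0%N = t.
Proof.
move=> irr; pose x := fix x k : R :=
  if k is k'.+1 then (x k' - (Num.floor (x k'))%:~R)^-1 else t.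
have xirr k : ~ int_commensurable (x k).
  elim: k => [//|k IH] [p [q [q0 qE]]]; apply: IH.
  (* An integral [x k] is set apart because the inverse of 0 is 0 by convention. Otherwise
     [x k.+1 = p / q] gives [x k = floor (x k) + q / p]. *)
  have [d0|d0] := eqVneq (x k - (Num.floor (x k))%:~R) 0.
    by exists (Num.floor (x k)), 1; split=> //; rewrite mul1r; apply/eqP; rewrite -subr_eq0 d0.
  exists (q + p * Num.floor (x k)), p; split.
    apply/eqP => p0; move: qE; rewrite p0 => /eqP.
    by rewrite mulf_eq0 intr_eq0 (negbTE q0) /= invr_eq0 (negbTE d0).
  rewrite rmorphD rmorphM /= -qE /=; by field.
exists (fun k => Num.floor (x k)), x; split=> // k; split; last first.
  by rewrite /= invrK addrC subrK.
have /andP[lo hi] := floor_itv (x k).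
rewrite /= invf_gt1; first by rewrite ltrBlDr; move: hi; rewrite rmorphD /=; lra.
rewrite subr_gt0 lt_neqAle lo andbT; apply/eqP => xE.
by apply: (xirr k); exists (Num.floor (x k)), 1; rewrite mul1r.
Qed.

(** All multiples of [t] lie in the lattice of step [1 / |q|], whatever [m] is, so the open interval
    from 0 to [1 / |q|] stays free. *)
Lemma commensurable_largest_gap_ge {R : realType} (t : R) (p q : int) m :
  q != 0 -> q%:~R * t = p%:~R -> (`|q%:~R|^-1%:E <= largest_gap t m)%E.
Proof.
move=> q0 qt; have r0 : 0 < `|q%:~R : R| by rewrite normr_gt0 intr_eq0.
apply: ereal_sup_ubound; exists ([set` `]0, `|q%:~R|^-1[] : set R); last first.
  by rewrite lebesgue_measure_itv /= lte_fin invr_gt0 r0 sube0.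
split; first exact: interval_is_interval.
apply/seteqP; split => // _ [[y yI [z _ <-]] [i /= im iE]].
move: yI; rewrite /= in_itv /= => /andP[y0].
move=> y1.
have qyE : q%:~R * y = (p * i%:Z - q * z)%:~R.
  rewrite rmorphB !rmorphM /= -pmulrn -qt.
  have -> : y = i%:R * t - z%:~R by rewrite iE addrK.
  by ring.
have : 0 < `|q%:~R * y| < 1.
  by rewrite normrM (gtr0_norm y0) mulr_gt0//= -ltr_pdivlMl// mulr1.
rewrite qyE -intr_norm ltr0z ltrz1; lia.
Qed.

(** * Estimates for the number of points times the gap *)

Lemma sqrt5_bounds {R : realType} :
  20 / 9 < Num.sqrt 5 :> R /\ Num.sqrt 5 * Num.sqrt 5 = 5 :> R.
Proof.
have ss : Num.sqrt 5 * Num.sqrt 5 = 5 :> R by rewrite -expr2 sqr_sqrtr.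
by have s0 : 0 <= Num.sqrt 5 :> R; [exact: sqrtr_ge0|split=> //; nra].
Qed.

(** The margin of 1/10 below 2 absorbs an error [|cf_err a x n|], which is at most 1/10 for
    [n >= 10]. *)
Lemma gap_bound_lt2 {R : realType} : 1 + 2 / Num.sqrt 5 < 19 / 10 :> R.
Proof.
have [s2 _] := @sqrt5_bounds R.
have : 2 / Num.sqrt 5 < 9 / 10 :> R by rewrite ltr_pdivrMr; lra.
lra.
Qed.

(* The left side is the length [`|cf_err a x n|] of the largest gap times the
   first number of points at which no gap of that length is left. *)
Lemma quotient_ge2_gap {R : realType} {a : nat -> int} {x : nat -> R} n :
  complete_quotients a x -> 2 <= a n.+1 ->
  2 <= (2 * den a n.+1 + den a n)%:~R * `|cf_err a x n|.
Proof.
move=> ax a2; have [d0 _] := den_gt0 ax n; have [_ xE] := ax n.+1.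
have /andP[i0 _] := complete_quotients_inv_lt1 a x n.+1 ax.
have a2R : 2 <= (a n.+1)%:~R :> R by rewrite (ler_int R 2).
have d0R : 0 <= (den a n)%:~R :> R by rewrite ler0z.
have e2 : 2 * `|cf_err a x n.+1| <= `|cf_err a x n|.
  by rewrite (cf_err_norm n ax) ler_wpM2r//; lra.
have sum1 := den_err_sum n ax; rewrite rmorphD rmorphM /=.
have := ler_wpM2l d0R e2; lra.
Qed.

Lemma cf_err_norm_le {R : realType} {a : nat -> int} {x : nat -> R} n :
  complete_quotients a x -> n%:R * `|cf_err a x n| <= 1.
Proof.
move=> ax; rewrite -[leRHS](den_err_sum n ax); have [d0 _] := den_gt0 ax n.
apply: (@le_trans _ _ ((den a n.+1)%:~R * `|cf_err a x n|)).
  by rewrite ler_wpM2r// pmulrn ler_int (den_ge n ax).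
by rewrite lerDl mulr_ge0// ler0z.
Qed.

(** Put [s = sqrt 5], [d = |cf_err a x n.+1|] and [e = den a n.+1 - phi * den a n]. Then [s] times
    the left side is [(s + 2) + phi * d * (e * (s - 2) - s)], and [e <= 1] makes the last factor at
    most -2. *)
Lemma golden_gap_lt {R : realType} {a : nat -> int} {x : nat -> R} n :
  complete_quotients a x -> x n.+1 = golden_ratio R ->
  (den a n.+1)%:~R - golden_ratio R * (den a n)%:~R <= 1 ->
  (2 * den a n.+1 + den a n - 1)%:~R * `|cf_err a x n| < 1 + 2 / Num.sqrt 5.
Proof.
move=> ax xg; have [s2 ss] := @sqrt5_bounds R.
have := den_err_sum n ax; rewrite (cf_err_norm n ax) xg rmorphB rmorphD rmorphM /=.
have : 0 < `|cf_err a x n.+1| by rewrite normr_gt0 cf_err_neq0.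
rewrite /golden_ratio -[X in X + _ / _](@mulfV _ (Num.sqrt 5)) ?gt_eqF; [|lra..].
rewrite -mulrDl ltr_pdivlMr; last by lra.
move: (Num.sqrt 5) s2 ss => s s2 ss; set u := (den a n.+1)%:~R; set v := (den a n)%:~R.
set d := `|_| => d0 sum1 e1.
set e := u - (1 + s) / 2 * v in e1.
have -> : (2 * u + v - 1) * ((1 + s) / 2 * d) * s
    = (s + 2) + (1 + s) / 2 * d * (e * (s - 2) - s).
  have <- : (s + 2) * (u * ((1 + s) / 2 * d) + v * d) = s + 2 by rewrite sum1 mulr1.
  rewrite /e -[RHS]addr0.
  (* The identity holds only modulo [s * s = 5]; this multiple of [s * s - 5] turns it into one that
     [field] can check. *)
  have <- : d * v * (s + 2) / 4 * (s * s - 5) = 0 by rewrite ss subrr mulr0.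
  by field.
rewrite gtrDl nmulr_llt0 ?mulr_gt0//; nra.
Qed.

(* [den a n.+1 - phi * den a n] is multiplied by [-1 / phi] at each step. *)
Lemma golden_den_cvg {R : realType} {a : nat -> int} {x : nat -> R} K :
  complete_quotients a x -> (forall k, a (K + k)%N = 1) ->
  exists J, forall n, (J <= n)%N ->
    (den a n.+1)%:~R - golden_ratio R * (den a n)%:~R <= 1.
Proof.
move=> ax a1; have [/andP[g1 g2] gE] := @golden_ratioE R.
set g := golden_ratio R in g1 g2 gE *; pose e n : R := (den a n.+1)%:~R - g * (den a n)%:~R.
have eE j : e (K + j)%N = geometric (e K) (- g^-1) j.
  elim: j => [|j IH] /=; first by rewrite addn0 expr0 mulr1.
  rewrite exprSr mulrA -[e K * _]IH addnS /e denSS -addnS a1 mul1r addnS rmorphD /=.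
  by rewrite {1}gE; field; lra.
have h1 : `|- g^-1| < 1 by rewrite normrN ger0_norm; lra.
have /cvgr0Pnorm_le /(_ 1 ltr01) [J _ small] := @cvg_geometric R (e K) _ h1.
exists (K + J)%N => n Jn; have -> : n = (K + (n - K))%N by lia.
by apply: le_trans (ler_norm _) _; rewrite -/(e _) eE; apply: small => /=; lia.
Qed.

(** Take the largest [n] with [den a n.+1 + den a n <= m + 1]. The gap is then at most
    [|cf_err a x n|], and since [a n.+1 = 1], failure at [n.+1] says
    [m + 1 <= 2 * den a n.+1 + den a n - 1]. *)
Lemma golden_tail_gap_lt {R : realType} {a : nat -> int} {x : nat -> R} K :
  complete_quotients a x -> (forall k, a (K + k)%N = 1 /\ x (K + k)%N = golden_ratio R) ->
  exists M : nat, (0 < M)%N /\ forall m : nat, (M <= m)%N ->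
    ((m + 1)%:R%:E * largest_gap (x 0%N) m < (1 + 2 / Num.sqrt 5)%:E)%E.
Proof.
move=> ax tail; have [J eJ] := golden_den_cvg K ax (fun k => (tail k).1).
pose L := maxn K J; exists (absz (den a L.+1 + den a L)%R).
have [d0 d1] := den_gt0 ax L; split; first lia.
move=> m Mm; pose P n := den a n.+1 + den a n <= m%:Z + 1.
have PL : P L by rewrite /P; lia.
have Pbound n : P n -> (n <= m.+1)%N.
  by rewrite /P; have := den_ge n ax; have [] := den_gt0 ax n; lia.
have [n Pn nmax] := ex_maxnP (ex_intro _ L PL) Pbound.
have Ln : (L <= n)%N := nmax L PL.
have nP : ~~ P n.+1 by apply/negP => /nmax; rewrite ltnn.
have [an xn] : a n.+1 = 1 /\ x n.+1 = golden_ratio R.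
  have -> : n.+1 = (K + (n.+1 - K))%N by move: Ln; rewrite /L; lia.
  exact: tail.
apply: le_lt_trans (_ : _ <= (m + 1)%:R%:E * `|cf_err a x n|%:E)%E _.
  by apply: lee_wpmul2l; [rewrite lee_fin|exact: largest_gap_le].
rewrite -EFinM lte_fin; apply: le_lt_trans (golden_gap_lt n ax xn _); last first.
  by apply: eJ; move: Ln; rewrite /L; lia.
rewrite ler_wpM2r// pmulrn ler_int; move: nP; rewrite /P denSS an; lia.
Qed.

(** * The two directions of the equivalence *)

(** A common tail has one limit, so the complete quotients [x m] and [y n] coincide, and [y n] is
    golden by uniqueness. *)
Lemma cf_equiv_golden_tail {R : realType} (theta : R) :
  cf_equiv theta (golden_ratio R) ->
  exists (a : nat -> int) (x : nat -> R) (K : nat),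
    [/\ complete_quotients a x, x 0%N = theta &
      forall k, a (K + k)%N = 1 /\ x (K + k)%N = golden_ratio R].
Proof.
move=> [a [b [acf bcf [m [n [_ _ ab]]]]]].
have [x [ax x0 xcf]] := simple_cf_complete_quotients _ _ acf.
have [y [bx y0 ycf]] := simple_cf_complete_quotients _ _ bcf.
exists a, x, m; split=> //.
have abE : (fun k => a (m + k)%N) = (fun k => b (n + k)%N) by apply/funext.
have xy : x m = y n.
  have [_ xl] := xcf m; have [_] := ycf n; rewrite -abE => yl.
  exact: cvg_unique xl yl.
apply: (@complete_quotients_golden _ (fun k => a (m + k)%N) (fun k => x (m + k)%N)).
  by move=> k; rewrite addnS; exact: ax.
by rewrite addn0 xy; case: (complete_quotients_golden bx y0 n).
Qed.

Lemma bounded_gap_irrational {R : realType} (theta : R) (M : nat) :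
  (forall m : nat, (M <= m)%N ->
    ((m + 1)%:R%:E * largest_gap theta m < (1 + 2 / Num.sqrt 5)%:E)%E) ->
  ~ int_commensurable theta.
Proof.
(* The gap never drops below [1 / |q|], so [2 * |q|] points already make the product at least 2. *)
move=> small [p [q [q0 qE]]]; pose m := maxn M (absz q * 2).
have q1 : 0 < `|q%:~R| :> R by rewrite normr_gt0 intr_eq0.
have := small m (leq_maxl _ _); apply/negP; rewrite -leNgt.
apply: le_trans (_ : _ <= (m + 1)%:R%:E * `|q%:~R|^-1%:E)%E _; last first.
  by apply: lee_wpmul2l; [rewrite lee_fin|exact: commensurable_largest_gap_ge qE].
rewrite -EFinM lee_fin ler_pdivlMr//.
have : (2 * `|q|)%:~R <= (Posz (m + 1))%:~R :> R by rewrite ler_int /m; lia.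
rewrite intrM intr_norm -pmulrn; have := @gap_bound_lt2 R; nra.
Qed.

Lemma bounded_gap_eventually1 {R : realType} {a : nat -> int} {x : nat -> R} (M : nat) :
  complete_quotients a x ->
  (forall m : nat, (M <= m)%N ->
    ((m + 1)%:R%:E * largest_gap (x 0%N) m < (1 + 2 / Num.sqrt 5)%:E)%E) ->
  forall k, (M + 11 <= k)%N -> a k = 1.
Proof.
move=> ax small [|n] nM; first lia.
apply/eqP/negPn/negP => an; have a1 := complete_quotients_ge1 a x n ax.
have a2 : 2 <= a n.+1 by move/eqP: an; lia.
have [d0 d1] := den_gt0 ax n; have dn := den_ge n ax.
(* This is the last [m] at which the gap [|cf_err a x n|] is guaranteed; the product is then at
   least [2 - |cf_err a x n|], hence at least 19/10. *)
pose m := absz (2 * den a n.+1 + den a n - 2)%R.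
have mE : m%:Z = 2 * den a n.+1 + den a n - 2 by rewrite /m; lia.
have := small m ltac:(lia); apply/negP; rewrite -leNgt.
apply: le_trans (_ : _ <= (m + 1)%:R%:E * `|cf_err a x n|%:E)%E _; last first.
  by apply: lee_wpmul2l; [rewrite lee_fin|apply: largest_gap_ge => //; lia].
rewrite -EFinM lee_fin.
have -> : (m + 1)%:R = (2 * den a n.+1 + den a n)%:~R - 1 :> R.
  by rewrite -(rmorphB _ _ 1) /= pmulrn; congr intmul; lia.
have := quotient_ge2_gap n ax a2; have := cf_err_norm_le n ax.
have n10 : 10 <= n%:R :> R by rewrite (ler_nat R 10); lia.
have := ler_wpM2r (normr_ge0 (cf_err a x n)) n10; have := @gap_bound_lt2 R.
rewrite mulrBl; lra.
Qed.

Theorem mainTheorem1 (R : realType) (theta : R) :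
  (exists M : nat, (0 < M)%N /\
     forall m : nat, (M <= m)%N ->
       (((m + 1)%:R%:E * largest_gap theta m)%E
          < (1 + 2 / Num.sqrt 5)%:E)%E)
  <-> cf_equiv theta (golden_ratio R).
Proof.
split=> [[M [_ small]]|/cf_equiv_golden_tail[a [x [K [ax <- tail]]]]]; last first.
  exact: golden_tail_gap_lt ax tail.
have [a [x [ax xE]]] := irrational_complete_quotients _ (bounded_gap_irrational _ _ small).
rewrite -xE in small *; have a1 := bounded_gap_eventually1 M ax small.
exists a, (fun=> 1); split; first exact: complete_quotients_cf.
  exact: (complete_quotients_cf _ _ golden_complete_quotients).
(* Prefixes must have positive length, so one quotient is dropped from the constant expansion. *)
by exists (M + 11)%N, 1%N; split=> [||k]; [lia|lia|apply: a1; lia].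
Qed.
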